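(* Let $d,n\ge1$, let $\mathbf Y=(Y^1,\dots,Y^n)\in\mathbb R^n$ and let $X_j^i\in[0,1]$ ($1\le i\le n$, $1\le j\le d$) be given. Let $H_1,\dots,H_d\subset\mathbb R^n$ be the cones of isotonic vectors defined in the context, and let $g^*$ be the projection of $\mathbf Y$ onto $H_1+\dots+H_d$, i.e. the minimizer of $\sum_{i=1}^n(Y^i-g^i)^2$ over $g\in H_1+\dots+H_d$. Let $g_j^{[r]}$, $r=0,1,2,\dots$, $j=1,\dots,d$, be the iterates of the isotonic backfitting algorithm defined in the context. Then for every $j=1,\dots,d$ the sequence $$g_{(r,j)}=\sum_{1\le k\le j}g_k^{[r]}+\sum_{j<k\le d}g_k^{[r-1]}$$ converges to $g^*$ as $r\to\infty$. Moreover, suppose that the problem of minimizing $$F(\mathbf Y,\mathbf g)=\sum_{i=1}^n(Y^i-g_1^i-\dots-g_d^i)^2$$ over $\mathbf g=(g_1,\dots,g_d)\in H_1\times\dots\times H_d$ has a solution $\mathbf g^*=(g_1^*,\dots,g_d^* )$ that is unique up to additive constants (i.e. for any other solution $(g_1,\dots,g_d)$, each $g_j-g_j^*$ is a vector with all entries equal). Then for every $j=1,\dots,d$ the sequence $g_j^{[r]}-g_j^*$ converges, as $r\to\infty$, to a vector with constant entries (all entries equal).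
   Context: For $j=1,\dots,d$, $H_j$ is the closed convex cone of vectors that are isotonic with respect to the order of the $j$-th covariate: $$H_j=\{v=(v^1,\dots,v^n)\in\mathbb R^n:\ X_j^p\le X_j^q\ \Rightarrow\ v^p\le v^q\ \text{ for all }1\le p,q\le n\}.$$ $\Pi(\cdot\mid H_j)$ denotes the Euclidean projection of $\mathbb R^n$ onto $H_j$ (one-dimensional isotonic least squares regression). Isotonic backfitting algorithm: start with $g_j^{[0]}=0\in\mathbb R^n$ for $j=1,\dots,d$, and for $r=1,2,\dots$ and, within each $r$, successively for $j=1,\dots,d$, set $$g_j^{[r]}=\Pi\big(\mathbf Y-g_1^{[r]}-\dots-g_{j-1}^{[r]}-g_{j+1}^{[r-1]}-\dots-g_d^{[r-1]}\,\big|\,H_j\big).$$ *)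

(* Defs.v *)
From HB Require Import structures.
From mathcomp Require Import all_boot all_order all_algebra.
From mathcomp Require Import all_classical all_reals all_analysis.

Set Implicit Arguments.
Unset Strict Implicit.
Unset Printing Implicit Defensive.

Import Order.TTheory GRing.Theory Num.Theory.
Import numFieldNormedType.Exports.

Local Open Scope classical_set_scope.
Local Open Scope ring_scope.

Section Backfitting.
Variables (R : realType) (d n : nat).

(* The norm that the library puts on 'rV[R]_n is the sup norm, so the Euclidean
   one is written out.  Both induce the same topology. *)
Definition sqnorm (v : 'rV[R]_n) : R := \sum_(i < n) v ord0 i ^+ 2.

Definition is_euclid_proj (H : set 'rV[R]_n) (y p : 'rV[R]_n) : Prop :=
  H p /\ forall h, H h -> sqnorm (y - p) <= sqnorm (y - h).

(* Minimizers are unique on convex sets; the default value 0 is only reached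
   when there is no minimizer. *)
Definition euclid_proj (H : set 'rV[R]_n) (y : 'rV[R]_n) : 'rV[R]_n :=
  xget 0 [set p | is_euclid_proj H y p].

(* [X i j] is the j-th covariate of the i-th observation. *)
Definition isotonic (X : 'M[R]_(n, d)) (j : 'I_d) : set 'rV[R]_n :=
  [set v | forall p q, X p j <= X q j -> v ord0 p <= v ord0 q].

Definition isotonic_sum (X : 'M[R]_(n, d)) : set 'rV[R]_n :=
  [set v | exists2 h : 'I_d -> 'rV[R]_n,
             forall j, isotonic X j (h j) & v = \sum_(j < d) h j].

(* A recursion along the lexicographic order of (r, j): it determines [g]
   completely. *)
Definition is_backfitting (X : 'M[R]_(n, d)) (Y : 'rV[R]_n)
    (g : nat -> 'I_d -> 'rV[R]_n) : Prop :=
  (forall j, g 0%N j = 0) /\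
  forall r j, g r.+1 j =
    euclid_proj (isotonic X j)
         (Y - \sum_(k < d | (k < j)%N) g r.+1 k - \sum_(k < d | (j < k)%N) g r k).

(* Meaningful for [0 < r]. *)
Definition backfit_sum (g : nat -> 'I_d -> 'rV[R]_n) (r : nat) (j : 'I_d) :
    'rV[R]_n :=
  \sum_(k < d | (k <= j)%N) g r k + \sum_(k < d | (j < k)%N) g r.-1 k.

Definition lsq (Y : 'rV[R]_n) (h : 'I_d -> 'rV[R]_n) : R :=
  \sum_(i < n) (Y ord0 i - \sum_(j < d) h j ord0 i) ^+ 2.

Definition is_lsq_solution (X : 'M[R]_(n, d)) (Y : 'rV[R]_n)
    (h : 'I_d -> 'rV[R]_n) : Prop :=
  (forall j, isotonic X j (h j)) /\
  forall h' : 'I_d -> 'rV[R]_n,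
    (forall j, isotonic X j (h' j)) -> lsq Y h <= lsq Y h'.

End Backfitting.

(* Main.v *)
Require Import Defs.
From HB Require Import structures.
From mathcomp Require Import all_boot all_order all_algebra.
From mathcomp Require Import all_classical all_reals all_analysis.
From mathcomp Require Import ring lra.

Set Implicit Arguments.
Unset Strict Implicit.
Unset Printing Implicit Defensive.

Import Order.TTheory GRing.Theory Num.Theory.
Import numFieldNormedType.Exports.

Local Open Scope classical_set_scope.
Local Open Scope ring_scope.

(** Each update is an exact projection onto a cone, so it lowers the loss
    [|Y - sum_k g_k|^2] by at least the squared length of the step.  By convexity and the
    optimality conditions of the projections, the excess of the loss over its minimum after a
    round is at most a constant times [q_r * (c + q_0 + ... + q_r)], where [q_r] is the square
    root of the decrease in round [r].  Since [sum q_r^2] is finite, an excess bounded away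
    from zero would force [q_r^2 >= a / r], contradicting the divergence of the harmonic
    series.  The squared distance from the fit to its projection is at most the excess of the
    loss, whence the first claim; the projection exists because a sum of polyhedral cones is
    polyhedral, hence closed.

    For the components, isotonic regression preserves the total of its input, so the totals of
    the [g_j] are constant after the first round.  After shifting [gs] to these totals, the
    difference [w] to [gs] has zero totals and its components sum to a vector tending to 0,
    while uniqueness says that the components of an admissible [w] with zero totals and zero
    sum vanish; compactness of a sphere then gives [w -> 0]. *)

(** * Euclidean inner product, compared with the sup norm *)

Section InnerProduct.
Variables (R : realType) (n : nat).
Implicit Types u v w : 'rV[R]_n.

Definition dot u v : R := \sum_(i < n) u ord0 i * v ord0 i.

Lemma dotC u v : dot u v = dot v u.
Proof. by apply: eq_bigr => i _; rewrite mulrC. Qed.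

Lemma dot_is_scalar u : scalar (dot u).
Proof.
move=> a v w; rewrite /dot mulr_sumr -big_split/=.
by apply: eq_bigr => i _; rewrite !mxE mulrDr mulrCA.
Qed.

HB.instance Definition _ u :=
  GRing.isLinear.Build R 'rV[R]_n R _ (dot u) (dot_is_scalar u).

Lemma dotBr u v w : dot u (v - w) = dot u v - dot u w.
Proof. exact: linearB. Qed.

Lemma dotNr u v : dot u (- v) = - dot u v.
Proof. exact: linearN. Qed.

Lemma dotZr u a v : dot u (a *: v) = a * dot u v.
Proof. exact: linearZ. Qed.

Lemma dotBl u v w : dot (u - v) w = dot u w - dot v w.
Proof. by rewrite dotC dotBr !(dotC w). Qed.

Lemma sqnormE v : sqnorm v = dot v v.
Proof. by apply: eq_bigr => i _; rewrite expr2. Qed.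

Lemma sqnorm_ge0 v : 0 <= sqnorm v.
Proof. by apply: sumr_ge0 => i _; exact: sqr_ge0. Qed.

Lemma sqnormB u v : sqnorm (u - v) = sqnorm u - 2 * dot u v + sqnorm v.
Proof. by rewrite !sqnormE dotBr !dotBl (dotC v u); ring. Qed.

Lemma le_coord_norm v i : `|v ord0 i| <= `|v|.
Proof.
rewrite [leRHS]/Num.norm/= mx_normrE.
by rewrite (le_bigmax _ (fun ij => `|v ij.1 ij.2|) (ord0, i)).
Qed.

Lemma dot_le_norm u v : dot u v <= n%:R * (`|u| * `|v|).
Proof.
apply: (@le_trans _ _ (\sum_(i < n) `|u| * `|v|)).
  apply: ler_sum => i _; rewrite (le_trans (ler_norm _))// normrM.
  by rewrite ler_pM// le_coord_norm.
by rewrite sumr_const card_ord mulr_natl.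
Qed.

Lemma norm_le_sqnorm v : `|v| ^+ 2 <= sqnorm v.
Proof.
have [->|v0] := eqVneq `|v| 0; first by rewrite expr0n sqnorm_ge0.
have [[i j] /= ->] : exists i, `|v| = `|v i.1 i.2| := mx_norm_neq0 v0.
rewrite (ord1 i) real_normK ?num_real//.
by rewrite /sqnorm (bigD1 j)//= lerDl; apply: sumr_ge0 => k _; exact: sqr_ge0.
Qed.

End InnerProduct.

(** * Optimality conditions for projections onto convex cones *)

Section ConeProjection.
Variables (R : realType) (n : nat) (H : set 'rV[R]_n).

Definition is_cone : Prop :=
  [/\ H 0, forall a v, 0 <= a -> H v -> H (a *: v)
    & forall u v, H u -> H v -> H (u + v)].

Hypothesis H_cone : is_cone.
Variables (y p : 'rV[R]_n).
Hypothesis p_proj : is_euclid_proj H y p.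

Lemma proj_variation (v : 'rV[R]_n) : (forall t : R, 0 <= t <= 1 -> H (p + t *: v)) ->
  dot (y - p) v <= 0.
Proof.
move=> Hv; rewrite leNgt; apply/negP => s0.
set s := dot _ _ in s0; set q := sqnorm v.
have q0 : 0 <= q by exact: sqnorm_ge0.
have sq0 : 0 < s + q by rewrite ltr_pwDl.
(* Moving by [t *: v] changes the squared distance by [t * (t * q - 2 * s)], negative because
   [t * q = s - t * s]. *)
pose t := s / (s + q).
have t01 : 0 <= t <= 1.
  apply/andP; split; first by rewrite divr_ge0// ltW.
  by rewrite /t ler_pdivrMr// mul1r lerDl.
have := p_proj.2 _ (Hv _ t01).
rewrite opprD addrA (sqnormB (y - p)) dotZr -/s.
have -> : sqnorm (t *: v) = t ^+ 2 * q.
  by rewrite /sqnorm mulr_sumr; apply: eq_bigr => i _; rewrite !mxE exprMn.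
have t0 : 0 < t by rewrite divr_gt0.
have ts : t * (s + q) = s by rewrite /t divfK// gt_eqF.
move=> h.
have : 0 <= t * (t * q - 2 * s) by lra.
rewrite pmulr_rge0//; nra.
Qed.

Lemma proj_cone_le v : H v -> dot (y - p) v <= 0.
Proof.
case: H_cone => _ HZ HD Hv; apply: proj_variation => t /andP[t0 _].
by apply: HD; [exact: p_proj.1|exact: HZ].
Qed.

(** Both [p] and [- p] are admissible directions at [p], as [(1 - t) *: p] stays in the cone. *)
Lemma proj_cone_eq0 : dot (y - p) p = 0.
Proof.
apply/eqP; rewrite eq_le proj_cone_le; last exact: p_proj.1.
rewrite -oppr_le0 -dotNr; apply: proj_variation => t /andP[_ t1].
have -> : p + t *: - p = (1 - t) *: p by rewrite scalerN scalerBl scale1r.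
by case: H_cone => _ HZ _; apply: HZ; [rewrite subr_ge0|exact: p_proj.1].
Qed.

Lemma proj_cone_sqnorm_le v : H v ->
  sqnorm (v - p) <= sqnorm (y - v) - sqnorm (y - p).
Proof.
move=> Hv; have -> : y - v = (y - p) - (v - p) by rewrite opprB addrA subrK.
rewrite (sqnormB (y - p)) dotBr proj_cone_eq0.
by have := proj_cone_le Hv; lra.
Qed.

End ConeProjection.

(** * Isotonic vectors and their sums form convex cones *)

Section IsotonicCones.
Variables (R : realType) (d n : nat) (X : 'M[R]_(n, d)).

Lemma isotonic_cone j : is_cone (isotonic X j).
Proof.
split=> [p q _|a v a0 Hv p q pq|u v Hu Hv p q pq]; rewrite !mxE//.
- by rewrite ler_wpM2l// Hv.
- by rewrite lerD ?Hu ?Hv.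
Qed.

Lemma isotonic_const j c : isotonic X j (const_mx c).
Proof. by move=> p q _; rewrite !mxE. Qed.

Lemma isotonic_sum_cone : is_cone (isotonic_sum X).
Proof.
split=> [|a _ a0 [h Hh ->]|_ _ [h Hh ->] [k Hk ->]].
- exists (fun=> 0); first by move=> j; case: (isotonic_cone j).
  by rewrite big1.
- exists (fun j => a *: h j); last by rewrite scaler_sumr.
  by move=> j; case: (isotonic_cone j) => _ + _; apply.
- exists (fun j => h j + k j); last by rewrite big_split.
  by move=> j; case: (isotonic_cone j) => _ _; apply.
Qed.

End IsotonicCones.

(** * Polyhedral cones and Fourier-Motzkin elimination *)

Section Polyhedral.
Variable R : realType.

Definition polyhedral (V : lmodType R) (P : set V) : Prop :=
  exists (I : finType) (f : I -> {scalar V}),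
    forall v, P v <-> forall i, 0 <= f i v.

(** The largest lower bound serves as [t], or the smallest upper bound if there is no lower one. *)
Lemma exists_between (I : finType) (A B : pred I) (l u : I -> R) :
  (forall i j, A i -> B j -> l i <= u j) ->
  exists t, (forall i, A i -> l i <= t) /\ (forall j, B j -> t <= u j).
Proof.
move=> lu; have [[i0 Ai0]|noA] := pselect (exists i, A i).
  exists (l [arg max_(i > i0 | A i) l i]%O).
  by case: arg_maxP => // i Ai lemax; split=> // j Bj; exact: lu.
have [[j0 Bj0]|noB] := pselect (exists j, B j).
  exists (u [arg min_(j < j0 | B j) u j]%O).
  case: arg_minP => // j Bj lemin; split=> // i Ai.
  by case: noA; exists i.
exists 0; split=> [i Ai|j Bj]; first by case: noA; exists i.
by case: noB; exists j.
Qed.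

(* Fourier-Motzkin elimination: constraints [f i] with [f i a] positive bound the parameter
   [t] from below, those with [f j a] negative bound it from above, and [t] exists iff every
   lower bound is at most every upper bound. *)
Lemma polyhedral_add_line (V : lmodType R) (P : set V) (a : V) :
  polyhedral P -> polyhedral [set v | exists t : R, P (v + t *: a)].
Proof.
case=> I [f Pf].
(* [comb i j] vanishes at [a]; its nonnegativity says that the lower bound from [i] is at most the
   upper bound from [j]. The form [\0] fills the indices that impose nothing. *)
pose comb i j : {scalar V} := (f i a \*: f j) \- (f j a \*: f i).
pose g (k : I + I * I) : {scalar V} :=
  match k with
  | inl i => if f i a == 0 then f i else \0
  | inr (i, j) => if (0 < f i a) && (f j a < 0) then comb i j else \0
  end.
exists (I + I * I)%type, g => v /=; split=> [[t /Pf Pt] k|gv].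
  have fE i : f i (v + t *: a) = f i v + t * f i a by rewrite linearD linearZ.
  case: k => [i|[i j]] /=.
    case: eqP => //= fi0; have := Pt i.
    by rewrite fE fi0 mulr0 addr0.
  case: ifP => //= /andP[fi fj]; have := Pt i; have := Pt j; rewrite !fE.
  have aux (x y p q : R) : 0 < x -> y < 0 -> 0 <= q + t * y -> 0 <= p + t * x ->
    0 <= x * q - y * p by nra.
  exact: aux.
have [t [tl tu]] : exists t, (forall i, 0 < f i a -> - f i v / f i a <= t) /\
    (forall j, f j a < 0 -> t <= - f j v / f j a).
  apply: exists_between => i j fi fj; have := gv (inr (i, j)).
  rewrite /= fi fj/= subr_ge0 => h.
  rewrite ler_pdivrMr// mulrAC ler_ndivlMr//.
  by rewrite !mulNr lerN2 mulrC (mulrC (f j v)).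
exists t; apply/Pf => i; rewrite linearD linearZ/=.
have [fi|fi|fi] := ltgtP (f i a) 0.
- by have := tu _ fi; rewrite ler_ndivlMr//; lra.
- by have := tl _ fi; rewrite ler_pdivrMr//; lra.
- by have := gv (inl i); rewrite /= fi eqxx mulr0 addr0.
Qed.

Lemma polyhedral_add_lines (V : lmodType R) (P : set V) (K : eqType) (s : seq K)
    (a : K -> V) : uniq s -> polyhedral P ->
  polyhedral [set v | exists c : K -> R, P (v + \sum_(k <- s) c k *: a k)].
Proof.
move=> + polyP; elim: s => [_|x s IHs /= /andP[xs /IHs/(polyhedral_add_line (a x))]].
  rewrite [X in polyhedral X](_ : _ = P)//; apply/seteqP; split=> v /=.
    by case=> c; rewrite big_nil addr0.
  by move=> Pv; exists (fun=> 0); rewrite big_nil addr0.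
congr polyhedral; apply/seteqP; split=> v /=.
  (* As [x] does not occur in [s], resetting its coefficient leaves the sum over [s] intact. *)
  case=> t [c Pc]; exists (fun k => if k == x then t else c k).
  rewrite big_cons eqxx addrA [X in v + _ + X](_ : _ = \sum_(k <- s) c k *: a k)//.
  apply: eq_big_seq => k ks; case: eqP => // kx.
  by rewrite -kx ks in xs.
by case=> c; rewrite big_cons addrA => Pc; exists (c x), c.
Qed.

Lemma polyhedral_preimage (V W : lmodType R) (f : {linear V -> W}) (P : set W) :
  polyhedral P -> polyhedral [set v | P (f v)].
Proof.
by case=> I [g Pg]; exists I, (fun i => g i \o f) => v; exact: Pg.
Qed.

Lemma scalar_rV_continuous n (f : {scalar 'rV[R]_n}) : continuous f.
Proof.
have -> : (f : 'rV[R]_n -> R) = fun v => \sum_(i < n) v ord0 i * f (delta_mx ord0 i).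
  apply/funext => v; rewrite {1}(row_sum_delta v) linear_sum/=.
  by apply: eq_bigr => i _; rewrite linearZ.
apply: continuous_big => [|i _ v]; first exact: add_continuous.
apply: (@continuousM _ _ (fun w : 'rV[R]_n => w ord0 i) (cst _)); last exact: cst_continuous.
exact: coord_continuous.
Qed.

Lemma polyhedral_closed n (P : set 'rV[R]_n) : polyhedral P -> closed P.
Proof.
case=> I [f Pf].
have -> : P = \bigcap_(i in [set: I]) (f i @^-1` [set x | 0 <= x]).
  apply/seteqP; split=> v; first by move=> /Pf fv i _; exact: fv.
  by move=> fv; apply/Pf => i; exact: fv.
apply: closed_bigI => i _; apply: preimage_closed; last exact: closed_ge.
by move=> v _; exact: scalar_rV_continuous.
Qed.

End Polyhedral.

Lemma closed_sublevel (R : realType) (T : topologicalType) (f : T -> R) (c : R) :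
  continuous f -> closed [set x | f x <= c].
Proof.
move=> fcont; apply: (@preimage_closed _ _ f [set x | x <= c]); last exact: closed_le.
by move=> x _; exact: fcont.
Qed.

(** * Existence of projections onto closed sets *)

Section ProjectionExists.
Variables (R : realType) (n : nat).

Lemma sqnorm_continuous : continuous (@sqnorm R n).
Proof.
apply: continuous_big => [|i _ v]; first exact: add_continuous.
apply: (@continuous_comp _ _ _ (fun w : 'rV[R]_n => w ord0 i) (fun x => x ^+ 2)).
  exact: coord_continuous.
exact: exprn_continuous.
Qed.

Lemma exists_euclid_proj (H : set 'rV[R]_n) (y : 'rV[R]_n) :
  closed H -> H !=set0 -> exists p, is_euclid_proj H y p.
Proof.
move=> Hcl [h0 Hh0].
have dist_continuous : continuous (fun h : 'rV[R]_n => sqnorm (y - h)).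
  move=> h; apply: continuous_comp; last exact: sqnorm_continuous.
  by apply: continuousB; [exact: cst_continuous|exact: cvg_id].
(* Only points at least as close to [y] as [h0] compete, and they form a compact set; its radius
   uses that [x ^+ 2 <= q] gives [x <= 1 + q]. *)
pose A := H `&` [set h | sqnorm (y - h) <= sqnorm (y - h0)].
have A0 : A !=set0 by exists h0; split => /=.
have cA : compact A.
  apply: bounded_closed_compact; last first.
    apply: closedI => //.
    exact: closed_sublevel.
  exists (`|y| + (1 + sqnorm (y - h0))); split; first exact: num_real.
  move=> M /ltW ltM h [_ /= hh0]; apply: le_trans ltM.
  have -> : h = y - (y - h) by rewrite opprB addrC subrK.
  rewrite (le_trans (ler_normB _ _))// lerD2l.
  have := le_trans (norm_le_sqnorm (y - h)) hh0.
  by have := normr_ge0 (y - h); nra.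
have [p] := compact_EVT_min A0 cA (continuous_subspaceT dist_continuous).
rewrite inE => -[Hp php0] pmin; exists p; split=> // h Hh.
have [hh0|/ltW hh0] := leP (sqnorm (y - h)) (sqnorm (y - h0)).
  by apply: pmin; rewrite inE.
exact: le_trans php0 hh0.
Qed.

Lemma euclid_projP (H : set 'rV[R]_n) (y : 'rV[R]_n) :
  closed H -> H !=set0 -> is_euclid_proj H y (euclid_proj H y).
Proof.
move=> Hcl H0; have [p py] := exists_euclid_proj y Hcl H0.
by rewrite /euclid_proj; case: xgetP => [_ -> //|/(_ p)].
Qed.

End ProjectionExists.

(** * The isotonic cones and their sum are closed *)

Section IsotonicClosed.
Variables (R : realType) (d n : nat) (X : 'M[R]_(n, d)).

Lemma dot_delta (v : 'rV[R]_n) i : dot (delta_mx ord0 i) v = v ord0 i.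
Proof.
rewrite /dot (bigD1 i)//= mxE !eqxx mul1r big1 ?addr0// => k /negPf ki.
by rewrite mxE ki andbF mul0r.
Qed.

Definition isotonic_form j (pq : 'I_n * 'I_n) : 'rV[R]_n :=
  if X pq.1 j <= X pq.2 j then delta_mx ord0 pq.2 - delta_mx ord0 pq.1 else 0.

Lemma isotonicE j v :
  isotonic X j v <-> forall pq, 0 <= dot (isotonic_form j pq) v.
Proof.
rewrite /isotonic_form; split=> [Hv [p q]|dv p q pq] /=.
  case: ifP => [pq|_]; first by rewrite dotBl !dot_delta subr_ge0 Hv.
  by rewrite dotC linear0.
by have := dv (p, q); rewrite /= pq dotBl !dot_delta subr_ge0.
Qed.

Lemma polyhedral_isotonic j : polyhedral (isotonic X j).
Proof.
by exists ('I_n * 'I_n)%type, (fun pq => dot (isotonic_form j pq)); exact: isotonicE.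
Qed.

Let inl_rV (v : 'rV[R]_n) : 'rV[R]_n * 'M[R]_(d, n) := (v, 0).

Let inl_rV_is_linear : linear inl_rV.
Proof. by move=> a u v; rewrite /inl_rV; congr pair; rewrite /= scaler0 addr0. Qed.

HB.instance Definition _ :=
  GRing.isLinear.Build R _ _ _ inl_rV inl_rV_is_linear.

(* The sum is the projection to [v] of the polyhedral cone of the pairs [(v, M)] such that the
   [j]-th row of [M] is in the [j]-th cone and the rows sum to [v]. *)
Lemma polyhedral_isotonic_sum : polyhedral (isotonic_sum X).
Proof.
pose V : lmodType R := ('rV[R]_n * 'M[R]_(d, n))%type.
pose Q : set V := [set w | (forall j, isotonic X j (row j w.2)) /\
  w.1 - const_mx 1 *m w.2 = 0].
have polyQ : polyhedral Q.
  (* The left indices express isotonicity of the rows; the right ones split each coordinate of the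
     equation into two opposite inequalities, with sign given by [b]. *)
  pose f (k : 'I_d * ('I_n * 'I_n) + bool * 'I_n) : {scalar V} :=
    match k with
    | inl (j, pq) => dot (isotonic_form j pq) \o (row j \o snd)
    | inr (b, i) => dot ((-1) ^+ b *: delta_mx ord0 i) \o
        (fst \- (mulmx (const_mx 1) \o snd))
    end.
  exists ('I_d * ('I_n * 'I_n) + bool * 'I_n)%type, f => w; split=> [[Hw w0]|fw].
    case=> [[j pq]|[b i]] /=; first by have /isotonicE := Hw j; exact.
    by rewrite w0 linear0.
  split=> [j|]; first by apply/isotonicE => pq; exact: fw (inl (j, pq)).
  apply/rowP => i; have := fw (inr (true, i)); have := fw (inr (false, i)).
  rewrite /= expr0 expr1 scale1r scaleN1r dot_delta dotC dotNr dotC.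
  by rewrite dot_delta oppr_ge0 => h1 h2; apply/eqP; rewrite [X in _ == X]mxE eq_le h1 h2.
(* Lines along all matrix units turn membership of [(v, 0)] into the existence of a suitable [M]. *)
pose a (k : 'I_d * 'I_n) : V := (0, delta_mx k.1 k.2).
have := polyhedral_preimage inl_rV
  (polyhedral_add_lines a (index_enum_uniq _) polyQ).
congr polyhedral; apply/seteqP.
have sumE v (c : 'I_d * 'I_n -> R) : inl_rV v + \sum_k c k *: a k =
    (v, \sum_k c k *: delta_mx k.1 k.2).
  apply: injective_projections => /=.
    by rewrite (raddf_sum fst) big1 ?addr0// => k _; rewrite /= scaler0.
  by rewrite add0r (raddf_sum snd).
split=> v /=.
  case=> c; rewrite sumE /Q/=; set M := \sum_k _ => -[HM /eqP].
  rewrite subr_eq0 => /eqP ->; exists (fun j => row j M) => //.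
  apply/rowP => i; rewrite mxE summxE; apply: eq_bigr => j _.
  by rewrite !mxE mul1r.
case=> h Hh ->; exists (fun k => h k.1 ord0 k.2); rewrite sumE.
pose M : 'M[R]_(d, n) := \matrix_(j, i) h j ord0 i.
have -> : \sum_k h k.1 ord0 k.2 *: delta_mx k.1 k.2 = M.
  rewrite (matrix_sum_delta M) pair_big/=.
  by apply: eq_bigr => k _; rewrite mxE.
split=> [j|] /=; first by rewrite (_ : row j M = h j)//; apply/rowP => i; rewrite !mxE.
apply/eqP; rewrite subr_eq0; apply/eqP/rowP => i.
by rewrite mxE summxE; apply: eq_bigr => j _; rewrite !mxE mul1r.
Qed.

Lemma euclid_proj_isotonic j y :
  is_euclid_proj (isotonic X j) y (euclid_proj (isotonic X j) y).
Proof.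
apply: euclid_projP; first exact: polyhedral_closed (polyhedral_isotonic j).
by exists 0; case: (isotonic_cone X j).
Qed.

Lemma euclid_proj_isotonic_sum y :
  is_euclid_proj (isotonic_sum X) y (euclid_proj (isotonic_sum X) y).
Proof.
apply: euclid_projP; first exact: polyhedral_closed polyhedral_isotonic_sum.
by exists 0; case: (isotonic_sum_cone X).
Qed.

End IsotonicClosed.

(** * Convergence of a decreasing sequence from a gap estimate *)

Section RealSequences.
Variable R : realType.

Lemma sum_sqr_le (u : nat -> R) r :
  (\sum_(s < r) u s) ^+ 2 <= r%:R * \sum_(s < r) u s ^+ 2.
Proof.
elim: r => [|r IHr]; first by rewrite !big_ord0 mulr0 expr0n.
rewrite !big_ord_recr/=; set S := \sum_(s < r) u s; set Q := \sum_(s < r) _.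
have Q0 : 0 <= Q by apply: sumr_ge0 => s _; exact: sqr_ge0.
rewrite -natr1 -/S -/Q in IHr *; have := IHr; rewrite -/S -/Q => {}IHr.
(* After multiplication by [r], this follows from the induction hypothesis and
   [0 <= (S - r%:R * u r) ^+ 2]. *)
suff : 2 * S * u r <= Q + r%:R * u r ^+ 2 by nra.
have [r0|r0] := eqVneq r 0%N.
  by rewrite /S /Q r0 !big_ord0; nra.
have {}r0 : 0 < r%:R :> R by rewrite ltr0n lt0n.
rewrite -(ler_pM2l r0).
have := sqr_ge0 (S - r%:R * u r); nra.
Qed.

(* If the gap stayed above [e], then the decrements would be at least a multiple of [1 / r],
   since the sum of the first [r] square roots is of order at most [sqrt r]. *)
Lemma cvg_of_gap (F : nat -> R) (Fs K c : R) : 0 <= K -> 0 <= c -> 0 <= Fs ->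
  (forall r, F r.+1 <= F r) -> (forall r, Fs <= F r) ->
  (forall r, F r.+1 - Fs <= K * Num.sqrt (F r - F r.+1) *
     (c + \sum_(s < r.+1) Num.sqrt (F s - F s.+1))) ->
  F r @[r --> \oo] --> Fs.
Proof.
move=> K0 c0 Fs0 Fdecr FFs gap.
have Fnincr : nonincreasing_seq F by apply/nonincreasing_seqP.
suff small e : 0 < e -> exists r, F r.+1 - Fs < e.
  apply/cvgrPdist_lt => e /small[r Fr]; near=> m.
  rewrite distrC ger0_norm ?subr_ge0//; apply: le_lt_trans Fr.
  by rewrite lerD2r Fnincr//; near: m; exact: nbhs_infty_ge.
move=> e0; apply: contrapT => /forallNP big.
have {}big r : e <= F r.+1 - Fs by rewrite leNgt; apply/negP/big.
pose delta r := F r - F r.+1.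
have delta0 r : 0 <= delta r by rewrite subr_ge0.
have sum_delta r : \sum_(s < r) delta s = F 0%N - F r.
  rewrite -(big_mkord xpredT delta) (telescope_sumr_eq (fun s => - F s))//.
    by rewrite opprK addrC.
  by move=> s _; rewrite opprK addrC.
(* [B * r.+1%:R] dominates [K ^+ 2 * (c + S) ^+ 2], where [S] is the sum of the first [r.+1] square
   roots; the summand 1 makes [B] positive. *)
pose B := 2 * K ^+ 2 * (c ^+ 2 + F 0%N) + 1.
have F0 : 0 <= F 0%N by rewrite (le_trans Fs0).
have B0 : 0 < B by rewrite ltr_wpDl// mulr_ge0 ?addr_ge0 ?mulr_ge0 ?sqr_ge0.
have delta_ge r : e ^+ 2 / B * r.+1%:R^-1 <= delta r.
  rewrite -mulrA -invfM ler_pdivrMr ?mulr_gt0//.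
  have := le_trans (big r) (gap r); rewrite -/(delta r).
  have := sum_sqr_le (fun s => Num.sqrt (delta s)) r.+1.
  under [X in _ <= _ * X]eq_bigr do rewrite sqr_sqrtr//.
  rewrite sum_delta /delta -/(delta r).
  set S := \sum_(s < _) _ => S2; set q := Num.sqrt _ => eq.
  have q2 : q ^+ 2 = delta r by rewrite sqr_sqrtr.
  have r1 : 1 <= r.+1%:R :> R by rewrite ler1n.
  have cS : (c + S) ^+ 2 <= 2 * r.+1%:R * (c ^+ 2 + F 0%N).
    have : 0 <= F r.+1 by rewrite (le_trans Fs0).
    have := sqr_ge0 (c - S); have := sqr_ge0 c; nra.
  have : e ^+ 2 <= (K * q * (c + S)) ^+ 2.
    by rewrite lerXn2r ?nnegrE//; [exact: ltW|exact: le_trans (ltW e0) eq].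
  move=> /le_trans; apply; rewrite !exprMn q2.
  have -> : K ^+ 2 * delta r * (c + S) ^+ 2 = delta r * (K ^+ 2 * (c + S) ^+ 2) by ring.
  rewrite ler_wpM2l//.
  have := ler_wpM2l (sqr_ge0 K) cS; rewrite /B; nra.
apply: (@dvg_harmonic R); apply: nondecreasing_is_cvgn.
  by apply: nondecreasing_series => i _ _ /=; rewrite invr_ge0.
exists (F 0%N / (e ^+ 2 / B)) => _ [r _ <-].
rewrite ler_pdivlMr ?divr_gt0 ?exprn_gt0// mulrC.
rewrite /series/= mulr_sumr big_mkord; apply: (@le_trans _ _ (\sum_(s < r) delta s)).
  by apply: ler_sum => s _; exact: delta_ge.
by rewrite sum_delta gerBl (le_trans Fs0).
Unshelve. all: by end_near. Qed.

End RealSequences.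

(** * Descent of the loss along the backfitting iterates *)

Section BackfittingDescent.
Variables (R : realType) (d n : nat) (X : 'M[R]_(n, d)) (Y : 'rV[R]_n).
Variable g : nat -> 'I_d -> 'rV[R]_n.
Hypothesis g_backfitting : is_backfitting X Y g.

(** The fit inside round [r.+1], once the components below [j] are updated. Taking [j] in [nat] lets
    [j = d] denote the end of the round. *)
Definition sweep (r j : nat) : 'rV[R]_n :=
  \sum_(k < d) (if (k < j)%N then g r.+1 k else g r k).

Lemma sweep0 r : sweep r 0 = \sum_(k < d) g r k.
Proof. by []. Qed.

Lemma sweep_full r : sweep r d = \sum_(k < d) g r.+1 k.
Proof. by apply: eq_bigr => k _; rewrite ltn_ord. Qed.

Lemma sweepS r (j : 'I_d) : sweep r j.+1 = sweep r j + (g r.+1 j - g r j).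
Proof.
rewrite /sweep (bigD1 j)//= [in RHS](bigD1 j)//= ltnS leqnn ltnn.
rewrite addrAC [g r j + _]addrC subrK; congr (_ + _).
apply: eq_bigr => k kj; rewrite ltnS leq_eqVlt.
by have -> : (k == j :> nat) = false by exact: negPf.
Qed.

Lemma sweepE r (j : 'I_d) :
  sweep r j = \sum_(k < d | (k < j)%N) g r.+1 k + \sum_(k < d | (j < k)%N) g r k + g r j.
Proof.
rewrite /sweep (bigD1 j)//= ltnn addrC; congr (_ + _).
rewrite !(big_mkcond (fun k : 'I_d => (_ < _)%N)) -big_split/= big_mkcond/=.
apply: eq_bigr => k _; have [kj|kj|kj] := ltngtP k j.
- by rewrite -val_eqE/= (ltn_eqF kj) addr0.
- by rewrite -val_eqE/= (gtn_eqF kj) add0r.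
- by rewrite (val_inj kj) eqxx addr0.
Qed.

Lemma backfit_sumE r (j : 'I_d) : backfit_sum g r.+1 j = sweep r j.+1.
Proof.
rewrite sweepS sweepE addrACA -addrA subrr addr0 addrAC /backfit_sum; congr (_ + _).
by rewrite (bigD1 j)//= addrC; congr (_ + _); apply: eq_bigl => k; rewrite ltn_neqAle andbC.
Qed.

Lemma residualS r (j : 'I_d) :
  Y - sweep r j.+1 = Y - sweep r j + g r j - g r.+1 j.
Proof. by rewrite sweepS !opprD opprK !addrA [LHS]addrAC. Qed.

Lemma backfitting_update r (j : 'I_d) :
  is_euclid_proj (isotonic X j) (Y - sweep r j + g r j) (g r.+1 j).
Proof.
have -> : Y - sweep r j + g r j =
    Y - \sum_(k < d | (k < j)%N) g r.+1 k - \sum_(k < d | (j < k)%N) g r k.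
  by rewrite sweepE !opprD !addrA subrK.
by rewrite g_backfitting.2; exact: euclid_proj_isotonic.
Qed.

Lemma iterate_isotonic r j : isotonic X j (g r j).
Proof.
case: r => [|r]; last exact: (backfitting_update r j).1.
by rewrite g_backfitting.1; case: (isotonic_cone X j).
Qed.

(** The residual right after the update of [j] is the projected vector minus its projection. *)
Lemma residual_le0 r (j : 'I_d) v : isotonic X j v -> dot (Y - sweep r j.+1) v <= 0.
Proof.
rewrite residualS; apply: proj_cone_le (backfitting_update r j) _.
exact: isotonic_cone.
Qed.

Lemma residual_eq0 r (j : 'I_d) : dot (Y - sweep r j.+1) (g r.+1 j) = 0.
Proof.
rewrite residualS; apply: proj_cone_eq0 (backfitting_update r j).
exact: isotonic_cone.
Qed.

(** The cross term has the right sign: the new residual is orthogonal to [g r.+1 j] and makes no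
    acute angle with [g r j]. *)
Lemma sqnorm_descent r (j : 'I_d) :
  sqnorm (Y - sweep r j.+1) + sqnorm (g r j - g r.+1 j) <= sqnorm (Y - sweep r j).
Proof.
have -> : Y - sweep r j = (Y - sweep r j.+1) - (g r j - g r.+1 j).
  by rewrite residualS opprB addrA subrK addrK.
rewrite (sqnormB (Y - _)) dotBr residual_eq0.
by have := residual_le0 r (@iterate_isotonic r j); lra.
Qed.

Lemma sqnorm_sweep_le r i j : (i <= j <= d)%N ->
  sqnorm (Y - sweep r j) <= sqnorm (Y - sweep r i).
Proof.
case/andP; elim: j => [|j IHj]; first by rewrite leqn0 => /eqP ->.
rewrite leq_eqVlt => /predU1P[->//|ij] jd; apply: le_trans (IHj ij (ltnW jd)).
have := sqnorm_descent r (Ordinal jd); apply: le_trans.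
by rewrite lerDl sqnorm_ge0.
Qed.

Definition loss r : R := sqnorm (Y - \sum_(k < d) g r k).

Lemma sqnorm_step_le r j : sqnorm (g r j - g r.+1 j) <= loss r - loss r.+1.
Proof.
rewrite lerBrDl /loss -sweep_full -(sweep0 r).
apply: le_trans (@sqnorm_sweep_le r 0%N j _); last exact: ltnW.
by apply: le_trans (sqnorm_descent r j); rewrite lerD2r sqnorm_sweep_le// ltn_ord leqnn.
Qed.

Lemma loss_decr r : loss r.+1 <= loss r.
Proof. by rewrite /loss -sweep_full -(sweep0 r) sqnorm_sweep_le// leqnn. Qed.

Definition root_decr r : R := Num.sqrt (loss r - loss r.+1).

Lemma norm_step_le r j : `|g r.+1 j - g r j| <= root_decr r.
Proof.
rewrite distrC -[leLHS]normr_id -sqrtr_sqr ler_wsqrtr//.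
exact: le_trans (norm_le_sqnorm _) (sqnorm_step_le r j).
Qed.

Lemma norm_iterate_le r j : `|g r j| <= \sum_(s < r) root_decr s.
Proof.
elim: r => [|r IHr]; first by rewrite g_backfitting.1 normr0 big_ord0.
rewrite big_ord_recr/= -[g r.+1 j](subrK (g r j)) addrC.
by rewrite (le_trans (ler_normD _ _))// lerD// norm_step_le.
Qed.

Lemma norm_sweep_tail_le r j : `|sweep r d - sweep r j| <= d%:R * root_decr r.
Proof.
rewrite -sumrB (le_trans (ler_norm_sum _ _ _))//.
rewrite -[X in X%:R * _]card_ord -sumr_const mulr_suml ler_sum// => k _.
rewrite ltn_ord mul1r; case: ifP => _; last exact: norm_step_le.
by rewrite subrr normr0 sqrtr_ge0.
Qed.

Lemma loss_gap r (h : 'I_d -> 'rV[R]_n) : (forall j, isotonic X j (h j)) ->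
  loss r.+1 - sqnorm (Y - \sum_(j < d) h j) <=
  (2 * d%:R * n%:R * d%:R) * root_decr r *
    (\sum_(j < d) `|h j| + \sum_(s < r.+1) root_decr s).
Proof.
move=> Hh; rewrite /loss -sweep_full; set x := Y - sweep r d.
have -> : Y - \sum_(j < d) h j = x - (\sum_(j < d) h j - sweep r d).
  by rewrite /x opprB addrA subrK.
rewrite (sqnormB x) sweep_full -sumrB.
set c := \sum_(j < d) `|h j|; set S := \sum_(s < r.+1) _.
(* Expanding the square bounds the gap by twice this inner product. *)
suff : dot x (\sum_(j < d) (h j - g r.+1 j)) <= d%:R * (n%:R * (d%:R * root_decr r * (c + S))).
  by have := sqnorm_ge0 (\sum_(j < d) (h j - g r.+1 j)); lra.
rewrite [leLHS]linear_sum/= -[X in X%:R * _]card_ord -sumr_const mulr_suml ler_sum// => j _.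
(* Against the residual just after the update of [j], [h j] contributes at most 0 and [g r.+1 j]
   exactly 0. What remains is the movement in the rest of the round, of norm at most
   [d%:R * root_decr r]. *)
have -> : x = (Y - sweep r j.+1) - (sweep r d - sweep r j.+1).
  by rewrite opprB addrA subrK.
rewrite dotBl dotBr residual_eq0 subr0 mul1r -dotNr opprB.
rewrite ler_wnDl ?residual_le0// (le_trans (dot_le_norm _ _))// ler_wpM2l//.
rewrite ler_pM// ?norm_sweep_tail_le// (le_trans (ler_normB _ _))// addrC lerD//.
  by rewrite /c (bigD1 j)//= lerDl sumr_ge0.
exact: norm_iterate_le.
Qed.

Lemma loss_cvg p : is_euclid_proj (isotonic_sum X) Y p ->
  loss r @[r --> \oo] --> sqnorm (Y - p).
Proof.
move=> [[h Hh ->] pmin].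
apply: (@cvg_of_gap _ _ _ (2 * d%:R * n%:R * d%:R) (\sum_(j < d) `|h j|)).
- by rewrite !mulr_ge0.
- exact: sumr_ge0.
- exact: sqnorm_ge0.
- exact: loss_decr.
- by move=> r; apply: pmin; exists (g r) => // j; exact: iterate_isotonic.
- by move=> r; exact: loss_gap.
Qed.

Lemma sweep_isotonic_sum r j : isotonic_sum X (sweep r j).
Proof.
exists (fun k : 'I_d => if (k < j)%N then g r.+1 k else g r k) => // k.
by case: ifP => _; exact: iterate_isotonic.
Qed.

Lemma backfit_sum_cvg p j : is_euclid_proj (isotonic_sum X) Y p ->
  backfit_sum g r j @[r --> \oo] --> p.
Proof.
(* The shift discards [r = 0], where [r.-1] is not a preceding round. *)
move=> p_proj; rewrite -cvg_shiftS /=.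
apply/cvgrPdist_lt => e e0; have /cvgrPdist_lt/(_ (e ^+ 2)) := loss_cvg p_proj.
rewrite exprn_gt0// => /(_ isT); apply: filterS => r; rewrite distrC => lt_e.
rewrite distrC -(ltr_pXn2r (n := 2))// ?nnegrE ?(ltW e0)//; apply: le_lt_trans lt_e.
rewrite (le_trans (norm_le_sqnorm _))// (le_trans _ (ler_norm _))// backfit_sumE.
apply: le_trans (proj_cone_sqnorm_le (isotonic_sum_cone X) p_proj (sweep_isotonic_sum _ _)) _.
by rewrite lerD2r /loss -sweep0 sqnorm_sweep_le// ltn_ord.
Qed.

Definition total (v : 'rV[R]_n) : R := dot (const_mx 1) v.

(** The constants 1 and -1 are both isotonic, so the residual has nonpositive inner product with
    each. *)
Lemma total_residual r (j : 'I_d) : total (Y - sweep r j.+1) = 0.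
Proof.
apply/eqP; rewrite /total dotC eq_le residual_le0; last exact: isotonic_const.
rewrite -oppr_le0 -dotNr residual_le0// -scaleN1r scalemx_const mulr1.
exact: isotonic_const.
Qed.

Lemma total_iterate r j : total (g r.+1 j) = total (g 1%N j).
Proof.
elim: r => // r <-; apply/eqP; rewrite -subr_eq0 -dotBr; apply/eqP.
(* The step is a difference of two consecutive residuals, each left by an update. For the first
   component, the earlier one was left by the last component of the previous round. *)
have -> : g r.+2 j - g r.+1 j = (Y - sweep r.+1 j) - (Y - sweep r.+1 j.+1).
  by rewrite residualS; move: (Y - _) => x; rewrite opprB [RHS]addrC [x + _]addrC opprD addrA subrK.
rewrite dotBr -!/(total _) total_residual subr0.
case: j => [[|j] jd] /=; last exact: total_residual r.+1 (Ordinal (ltnW jd)).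
have d1 : (d.-1 < d)%N by rewrite ltn_predL.
have := total_residual r (Ordinal d1).
by rewrite /= (ltn_predK jd) sweep_full sweep0.
Qed.

End BackfittingDescent.

(** * Compactness bound for components whose sum is small *)

Section Compactness.
Variables (R : realType) (d n : nat) (X : 'M[R]_(n, d)).

Lemma linear_rV_continuous m k (f : {linear 'rV[R]_m -> 'rV[R]_k}) : continuous f.
Proof.
have -> : (f : 'rV[R]_m -> _) =
    fun v => \sum_(i < m) v ord0 i *: f (delta_mx ord0 i).
  apply/funext => v; rewrite {1}(row_sum_delta v) linear_sum/=.
  by apply: eq_bigr => i _; rewrite linearZ.
apply: continuous_big => [|i _ v]; first exact: add_continuous.
apply: (@continuousZr_tmp _ _ _ (fun w : 'rV[R]_m => w ord0 i)).
exact: coord_continuous.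
Qed.

Lemma isotonic_addc j (v : 'rV[R]_n) c : isotonic X j (v + const_mx c) -> isotonic X j v.
Proof. by move=> Hv p q /Hv; rewrite !mxE lerD2r. Qed.

(** A family of [d] vectors is stored as one row vector, so that finite-dimensional compactness
    applies. *)
Let block j : {linear 'rV[R]_(d * n) -> 'rV[R]_n} := row j \o vec_mx.

(* A [w] of norm at least [e] scales down to norm [e] without leaving the convex constraint set,
   and on that compact sphere [sqnorm (\sum_j w j)] has a positive minimum. *)
Lemma isotonic_near_kernel (G : 'I_d -> 'rV[R]_n) (e : R) :
  (forall j, isotonic X j (G j)) ->
  (forall w : 'I_d -> 'rV[R]_n, (forall j, isotonic X j (G j + w j)) ->
    (forall j, total (w j) = 0) -> \sum_(j < d) w j = 0 -> forall j, w j = 0) ->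
  0 < e -> exists2 m, 0 < m &
    forall w : 'I_d -> 'rV[R]_n, (forall j, isotonic X j (G j + w j)) ->
    (forall j, total (w j) = 0) -> sqnorm (\sum_(j < d) w j) < m ->
    forall j, `|w j| < e.
Proof.
move=> HG ker0 e0.
pose K := [set v : 'rV[R]_(d * n) | `|v| = e] `&`
  ([set v | forall j, isotonic X j (G j + block j v)] `&`
   [set v | forall j, total (block j v) = 0]).
pose phi (v : 'rV[R]_(d * n)) := sqnorm (\sum_(j < d) block j v).
have phi_continuous : continuous phi.
  move=> v; apply: continuous_comp; last exact: sqnorm_continuous.
  apply: continuous_big => [|j _]; first exact: add_continuous.
  exact: linear_rV_continuous.
have Kclosed : closed K.
  apply: closedI; last apply: closedI.
  - apply: (@preimage_closed _ _ (fun v : 'rV[R]_(d * n) => `|v|) [set e]).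
      by move=> v _; exact: norm_continuous.
    exact: closed_eq.
  - have -> : [set v | forall j, isotonic X j (G j + block j v)] =
        \bigcap_(j in [set: 'I_d]) ((fun v => G j + block j v) @^-1` isotonic X j).
      by apply/seteqP; split=> v /= Hv j; [move=> _; exact: Hv|exact: (Hv j I)].
    apply: closed_bigI => j _; apply: preimage_closed.
      move=> v _; apply: continuousD; first exact: cst_continuous.
      exact: linear_rV_continuous.
    exact: polyhedral_closed (polyhedral_isotonic X j).
  - have -> : [set v | forall j, total (block j v) = 0] =
        \bigcap_(j in [set: 'I_d]) ((fun v => total (block j v)) @^-1` [set 0]).
      by apply/seteqP; split=> v /= Hv j; [move=> _; exact: Hv|exact: (Hv j I)].
    apply: closed_bigI => j _; apply: preimage_closed; last exact: closed_eq.
    move=> v _; apply: continuous_comp; first exact: linear_rV_continuous.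
    exact: scalar_rV_continuous.
have Kcompact : compact K.
  apply: bounded_closed_compact => //; exists e; split; first exact: num_real.
  by move=> M /ltW eM v [/= -> _].
have [m m0 phi_ge] : exists2 m, 0 < m & forall v, K v -> m <= phi v.
  have [K0|/nonemptyPn K0] := pselect (K !=set0); last first.
    by exists 1 => // v; rewrite K0.
  have [c] := compact_EVT_min K0 Kcompact (continuous_subspaceT phi_continuous).
  rewrite inE => Kc cmin; exists (phi c); last by move=> v Kv; apply: cmin; rewrite inE.
  rewrite lt0r sqnorm_ge0 andbT; apply/eqP => phic0.
  (* A zero minimum would be attained at a family that [ker0] forces to vanish, although its norm is
     [e]. *)
  have c0 : c = 0.
    case: Kc => _ [Hc tc]; apply: (can_inj vec_mxK); rewrite linear0.
    apply/row_matrixP => j; rewrite row0; apply: (ker0 (fun j => block j c)) => //.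
    apply/eqP; rewrite -normr_eq0 -sqrf_eq0 eq_le sqr_ge0 andbT -phic0.
    exact: norm_le_sqnorm.
  by case: Kc => /= + _; rewrite c0 normr0 => /eqP; rewrite lt_eqF.
exists m => // w Hw tw phiw.
pose v := mxvec (\matrix_(j, i) w j ord0 i).
have blockv j : block j v = w j.
  by apply/rowP => i; rewrite /block/= mxvecK !mxE.
suff ve : `|v| < e.
  move=> j; have [->|wj0] := eqVneq `|w j| 0; first by [].
  have [[i0 i] /= ->] : exists i, `|w j| = `|w j i.1 i.2| := mx_norm_neq0 wj0.
  apply: le_lt_trans ve; have := le_coord_norm v (mxvec_index j i).
  by rewrite mxvecE mxE (ord1 i0).
rewrite ltNge; apply/negP => ev.
have v0 : 0 < `|v| by exact: lt_le_trans ev.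
pose t := e / `|v|.
have t0 : 0 <= t by rewrite divr_ge0 ?ltW.
have t1 : t <= 1 by rewrite /t ler_pdivrMr// mul1r.
have : K (t *: v).
  split; [|split] => [|j|j] /=.
  - by rewrite normrZ ger0_norm// /t divfK// gt_eqF.
  - have -> : G j + block j (t *: v) = (1 - t) *: G j + t *: (G j + w j).
      by rewrite linearZ/= -blockv scalerDr addrA -scalerDl subrK scale1r.
    case: (isotonic_cone X j) => _ HZ HD.
    by apply: HD; apply: HZ; rewrite ?subr_ge0.
  - have btv : block j (t *: v) = t *: w j by rewrite -blockv; exact: linearZ.
    by rewrite [row _ _]btv /total dotZr [dot _ _]tw mulr0.
move=> /phi_ge; rewrite leNgt => /negP; apply; apply: le_lt_trans phiw.
have -> : phi (t *: v) = t ^+ 2 * sqnorm (\sum_(j < d) w j).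
  rewrite /phi -(eq_bigr _ (fun j _ => blockv j)) /sqnorm mulr_sumr.
  apply: eq_bigr => i _; rewrite -exprMn !summxE mulr_sumr; congr (_ ^+ 2).
  by apply: eq_bigr => j _; rewrite linearZ mxE.
by rewrite ler_piMl ?sqnorm_ge0// expr_le1.
Qed.

End Compactness.

(** * Least squares solutions and centering *)

Section LeastSquares.
Variables (R : realType) (d n : nat) (X : 'M[R]_(n, d)) (Y : 'rV[R]_n).

Lemma lsqE (h : 'I_d -> 'rV[R]_n) : lsq Y h = sqnorm (Y - \sum_(j < d) h j).
Proof. by apply: eq_bigr => i _; rewrite !mxE summxE. Qed.

Lemma lsq_solutionP (h : 'I_d -> 'rV[R]_n) : is_lsq_solution X Y h <->
  (forall j, isotonic X j (h j)) /\ is_euclid_proj (isotonic_sum X) Y (\sum_(j < d) h j).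
Proof.
split=> -[Hh hmin]; split=> //.
  split; first by exists h.
  by move=> _ [k Hk ->]; rewrite -!lsqE hmin.
by move=> k Hk; rewrite !lsqE; apply: hmin.2; exists k.
Qed.

Lemma total_const c : total (const_mx c : 'rV[R]_n) = n%:R * c.
Proof.
rewrite /total /dot (eq_bigr (fun=> c)); first by rewrite sumr_const card_ord mulr_natl.
by move=> i _; rewrite !mxE mul1r.
Qed.

(** Pythagoras: a vector with zero total is orthogonal to the constants. *)
Lemma sqnorm_sub_const_le (v : 'rV[R]_n) c : total (v - const_mx c) = 0 ->
  sqnorm (v - const_mx c) <= sqnorm v.
Proof.
set z := v - _; move=> tot0.
have -> : v = z - - const_mx c by rewrite opprK subrK.
rewrite (sqnormB z) dotNr.
have -> : dot z (const_mx c) = 0.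
  have -> : (const_mx c : 'rV[R]_n) = c *: const_mx 1 by rewrite scalemx_const mulr1.
  by rewrite dotZr dotC [dot _ _]tot0 mulr0.
by have := sqnorm_ge0 (- const_mx c : 'rV[R]_n); lra.
Qed.

End LeastSquares.

(** * Convergence of the components up to constants *)

Section ComponentConvergence.
Variables (R : realType) (d n : nat) (n_gt0 : (0 < n)%N).
Variables (X : 'M[R]_(n, d)) (Y : 'rV[R]_n).
Variable g : nat -> 'I_d -> 'rV[R]_n.
Hypothesis g_backfitting : is_backfitting X Y g.

Lemma component_cvg (gs : 'I_d -> 'rV[R]_n) : is_lsq_solution X Y gs ->
  (forall h : 'I_d -> 'rV[R]_n, is_lsq_solution X Y h ->
     forall j, exists c : R, h j - gs j = const_mx c) ->
  forall j, exists c : R, (g r j - gs j) @[r --> \oo] --> (const_mx c : 'rV[R]_n).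
Proof.
move=> /lsq_solutionP[Hgs gs_proj] uniq_gs j0.
have n0 : n%:R != 0 :> R by rewrite pnatr_eq0 -lt0n.
(* The shift giving [gs j] the total shared by all [g r.+1 j]; it is also the limiting constant. *)
pose c j := n%:R^-1 * (total (g 1%N j) - total (gs j)).
pose G j : 'rV[R]_n := gs j + const_mx (c j).
pose w r j := g r.+1 j - G j.
have HG j : isotonic X j (G j).
  by case: (isotonic_cone X j) => _ _; apply; [exact: Hgs|exact: isotonic_const].
have total_w r j : total (w r j) = 0.
  rewrite /w /G opprD addrA /total !dotBr -!/(total _).
  by rewrite (total_iterate g_backfitting) total_const /c mulrA divff// mul1r subrr.
exists (c j0); rewrite -cvg_shiftS /=; apply/cvgrPdist_lt => e e0.
have [|m m0 small] := isotonic_near_kernel HG _ e0.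
  (* Here [gs + u] is again a solution, so each [u j] is constant, and its zero total makes it 0. *)
  move=> u Hu tu su j.
  have : is_lsq_solution X Y (fun j => gs j + u j).
    apply/lsq_solutionP; split=> [k|]; last by rewrite big_split/= su addr0.
    by apply: (@isotonic_addc _ _ _ _ _ _ (c k)); rewrite addrAC; exact: Hu.
  move=> /uniq_gs/(_ j)[b]; rewrite addrC addKr => ub.
  have /eqP := tu j; rewrite ub total_const mulf_eq0 (negPf n0)/= => /eqP ->.
  by apply/rowP => i; rewrite !mxE.
have loss_small := loss_cvg g_backfitting gs_proj.
rewrite -cvg_shiftS in loss_small; move/cvgrPdist_lt/(_ m m0): loss_small.
apply: filterS => r; rewrite distrC => lt_m.
have -> : const_mx (c j0) - (g r.+1 j0 - gs j0) = - w r j0.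
  by rewrite /w /G !opprB addrCA addrA.
rewrite normrN; apply: (small (w r)) => [j|j|].
- by rewrite /w addrC subrK; exact: (@iterate_isotonic _ _ _ _ _ _ g_backfitting).
- exact: total_w.
apply: le_lt_trans lt_m; apply: le_trans (ler_norm _).
(* The shifts add up to a single constant vector, whose subtraction does not increase the norm, as
   the total of the sum is 0. *)
have sum_w : \sum_(j < d) w r j =
    (\sum_(j < d) g r.+1 j - \sum_(j < d) gs j) - const_mx (\sum_(j < d) c j).
  have -> : const_mx (\sum_(j < d) c j) = \sum_(j < d) const_mx (c j) :> 'rV[R]_n.
    by apply/rowP => i; rewrite mxE summxE; apply: eq_bigr => j _; rewrite mxE.
  by rewrite -!sumrB; apply: eq_bigr => j _; rewrite /w /G opprD addrA.
rewrite sum_w; apply: le_trans (sqnorm_sub_const_le _) _.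
  by rewrite -sum_w /total linear_sum big1// => j _; exact: total_w.
apply: (proj_cone_sqnorm_le (isotonic_sum_cone X) gs_proj).
by exists (g r.+1) => // j; exact: (@iterate_isotonic _ _ _ _ _ _ g_backfitting).
Qed.

End ComponentConvergence.

Theorem theorem2 (R : realType) (d n : nat) (d_gt0 : (0 < d)%N) (n_gt0 : (0 < n)%N)
    (X : 'M[R]_(n, d)) (Y : 'rV[R]_n)
    (X01 : forall i j, 0 <= X i j <= 1)
    (g : nat -> 'I_d -> 'rV[R]_n) (g_backfitting : is_backfitting X Y g) :
  (forall j : 'I_d,
     backfit_sum g r j @[r --> \oo] --> euclid_proj (isotonic_sum X) Y) /\
  (forall gs : 'I_d -> 'rV[R]_n,
     is_lsq_solution X Y gs ->
     (forall h : 'I_d -> 'rV[R]_n, is_lsq_solution X Y h ->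
        forall j, exists c : R, h j - gs j = const_mx c) ->
     forall j : 'I_d, exists c : R,
       (g r j - gs j) @[r --> \oo] --> (const_mx c : 'rV[R]_n)).
Proof.
split=> [j|gs]; last exact: component_cvg.
exact: backfit_sum_cvg (euclid_proj_isotonic_sum X Y).
Qed.
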